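(* Let $n$ and $b$ be positive integers with $b \leq \frac{n}{2}-2$. In the $b$-biased orientation game on the edges of $K_n$, Maker has a strategy guaranteeing that the tournament obtained at the end of the game contains a directed cycle.
   Context: The $b$-biased (i.e. $(1:b)$) orientation game on $K_n$: two players, Maker and Breaker, take turns in orienting (directing) previously undirected edges of the complete graph $K_n$. Maker starts. In each round Maker orients exactly one previously undirected edge, and then Breaker orients at least one and at most $b$ previously undirected edges (if any remain). The players see all moves. The game ends when all edges are oriented, so that a tournament on the $n$ vertices is obtained. A cycle in this tournament counts no matter which player oriented each of its edges. *)

(* Defs.v *)
From mathcomp Require Import all_boot all_order all_algebra.

Set Implicit Arguments.
Unset Strict Implicit.
Unset Printing Implicit Defensive.

(* The pair (u, v) is the edge uv oriented from u to v.  A position of the game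
   is the set of all directed edges so far, and a move is the set of directed
   edges added by one player in one turn. *)
Notation dedge n := ('I_n * 'I_n)%type.

Definition rev_edge n (e : dedge n) : dedge n := (e.2, e.1).

Definition undirected n (D : {set dedge n}) (e : dedge n) : bool :=
  [&& e.1 != e.2, e \notin D & rev_edge e \notin D].

(* The second conjunct forbids orienting one edge both ways in one turn, so
   that #|A| is the number of edges that A orients. *)
Definition orients n (D A : {set dedge n}) : bool :=
  [forall e in A, undirected D e && (rev_edge e \notin A)].

Definition maker_move n (D A : {set dedge n}) : bool :=
  orients D A && (#|A| == 1).

Definition breaker_move n (b : nat) (D A : {set dedge n}) : bool :=
  orients D A && (1 <= #|A| <= b).

Definition game_over n (D : {set dedge n}) : bool :=
  ~~ [exists e, undirected D e].

(* A history lists the moves in chronological order.  Maker starts, so it is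
   Maker's turn exactly when the history has even length. *)
Notation history n := (seq {set dedge n}).

Definition position n (h : history n) : {set dedge n} := \bigcup_(A <- h) A.

Definition maker_to_move n (h : history n) : bool :=
  ~~ odd (size h) && ~~ game_over (position h).

Definition breaker_to_move n (h : history n) : bool :=
  odd (size h) && ~~ game_over (position h).

Definition strategy n := history n -> {set dedge n}.

(* The histories that can arise when Maker follows S and Breaker plays
   arbitrary legal moves. *)
Inductive consistent n (b : nat) (S : strategy n) : history n -> Prop :=
| consistent_start : consistent b S [::]
| consistent_maker h of consistent b S h & maker_to_move h :
    consistent b S (rcons h (S h))
| consistent_breaker h A of consistent b S h & breaker_to_move h
    & breaker_move b (position h) A :
    consistent b S (rcons h A).

Definition maker_strategy n (b : nat) (S : strategy n) : Prop :=
  forall h, consistent b S h -> maker_to_move h ->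
    maker_move (position h) (S h).

(* Every turn orients at least one edge, so every play reaches a final
   position. *)
Definition guarantees n (b : nat) (S : strategy n)
    (P : {set dedge n} -> Prop) : Prop :=
  forall h, consistent b S h -> game_over (position h) -> P (position h).

Definition has_directed_cycle n (D : {set dedge n}) : Prop :=
  exists2 c : seq 'I_n, 3 <= size c & ucycle (fun u v => (u, v) \in D) c.

(* Main.v *)
Require Import Defs.
From mathcomp Require Import all_boot all_order all_algebra.
From mathcomp Require Import zify.

Set Implicit Arguments.
Unset Strict Implicit.
Unset Printing Implicit Defensive.

Import GRing.Theory Num.Theory.

(** Maker grows a directed path by one vertex per turn.  Given a path and a
    vertex [w] outside it, [w] can be inserted as in the proof of Redei's
    theorem that tournaments have Hamiltonian paths: just before the first
    vertex of the path that does not already point to [w], or at the end if all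
    of them do.  This uses at most one edge that is still undirected, and Maker
    orients that one ([insert_vertex], [extend_path]).  Once the path spans all
    [n] vertices, any undirected edge joins two non-consecutive vertices of the
    path, and orienting it backwards closes a cycle ([close_cycle]).  So after
    [t] turns of Maker there is a directed cycle, or a directed path on [t + 1]
    vertices ([play_advanced]).

    Without a cycle, [t <= n - 1].  As each round orients at most [b + 1] edges,
    at most [(n - 1) * (b + 1)] edges are oriented by then; this is less than
    the [n * (n - 1) / 2] edges of the complete graph, since [b + 1 < n / 2].
    Hence the game is not over ([card_play], [game_over_card]). *)

Definition arc n (D : {set dedge n}) : rel 'I_n := fun u v => (u, v) \in D.

(** Path and cycle existence are boolean, by bounding the lengths, so that
    Maker's move can be found by [pick], a search over finitely many sets. *)
Definition traceable n k (D : {set dedge n}) : bool :=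
  [exists t : k.-tuple 'I_n, uniq t && sorted (arc D) t].

Definition cyclic n (D : {set dedge n}) : bool :=
  [exists k : 'I_n.+1, exists t : k.-tuple 'I_n,
     [&& 3 <= k, cycle (arc D) t & uniq t]].

Definition advanced n k (D : {set dedge n}) : bool :=
  cyclic D || traceable k D.

Lemma traceableP n k (D : {set dedge n}) :
  reflect (exists s, [/\ size s = k, uniq s & sorted (arc D) s])
          (traceable k D).
Proof.
apply: (iffP existsP) => [[t /andP[Ut Dt]] | [s [sz_s Us Ds]]].
  by exists t; rewrite size_tuple.
by exists (tcast sz_s (in_tuple s)); rewrite val_tcast Us.
Qed.

Lemma cyclicP n (D : {set dedge n}) :
  reflect (has_directed_cycle D) (cyclic D).
Proof.
apply: (iffP existsP) => [[k /existsP[t /and3P[k3 Dt Ut]]] | [c c3]].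
  by exists t; rewrite ?size_tuple // /ucycle Dt Ut.
case/andP=> Dc Uc.
have lt_c : size c < n.+1.
  by rewrite ltnS -[leqRHS]card_ord -(card_uniqP Uc) max_card.
exists (Ordinal lt_c); apply/existsP; exists (in_tuple c).
by rewrite /= c3 Uc andbT.
Qed.

Lemma sub_arc n (D D' : {set dedge n}) :
  D \subset D' -> subrel (arc D) (arc D').
Proof. by move=> /subsetP sDD' u v /sDD'. Qed.

Lemma advancedS n k (D D' : {set dedge n}) :
  D \subset D' -> advanced k D -> advanced k D'.
Proof.
move=> /sub_arc sDD' /orP[/existsP[i /existsP[t /and3P[k3 Dt Ut]]] | ].
  apply/orP; left; apply/existsP; exists i; apply/existsP; exists t.
  by rewrite k3 Ut (sub_cycle sDD' Dt).
case/existsP=> t /andP[Ut Dt]; apply/orP; right; apply/existsP; exists t.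
by rewrite Ut (sub_sorted sDD' Dt).
Qed.

Lemma maker_move1 n (D : {set dedge n}) e :
  undirected D e -> maker_move D [set e].
Proof.
case: e => u v uD; rewrite /maker_move cards1 eqxx andbT.
apply/forall_inP=> _ /set1P->; rewrite uD inE /rev_edge /= xpair_eqE.
by case/and3P: uD => /negPf/= nuv _ _; rewrite eq_sym nuv.
Qed.

Lemma undirected_rev n (D : {set dedge n}) e :
  undirected D (rev_edge e) = undirected D e.
Proof.
by case: e => u v; rewrite /undirected /rev_edge /= eq_sym [X in _ && X]andbC.
Qed.

Lemma undirectedN n (D : {set dedge n}) u v : u != v ->
  undirected D (u, v) = ((u, v) \notin D) && ((v, u) \notin D).
Proof. by move=> nuv; rewrite /undirected /= nuv. Qed.

Lemma perm_cons_swap (T : eqType) (x w : T) p q :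
  perm_eq q (w :: p) -> perm_eq (x :: q) [:: w, x & p].
Proof.
move=> pq; apply: (@perm_trans _ [:: x, w & p]); first by rewrite perm_cons.
exact/permPl/(perm_catCA [:: x] [:: w]).
Qed.

(** The edge [e0] is the move for Maker when no edge needs to be oriented: the
    rules do not let Maker pass. *)
Lemma insert_vertex n (D : {set dedge n}) e0 w x p :
    undirected D e0 -> path (arc D) x p -> w \notin x :: p -> (x, w) \in D ->
  exists e q, [/\ undirected D e, perm_eq q (w :: p)
                & path (arc (e |: D)) x q].
Proof.
move=> e0D; have sD e : subrel (arc D) (arc (e |: D)).
  exact/sub_arc/subsetUr.
elim: p x => [|y p IHp] x /=.
  by move=> _ _ xw; exists e0, [:: w]; rewrite /= andbT [arc _ _ _]sD.
case/andP=> xy Dp; rewrite inE negb_or => /andP[_ wp] xw.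
have [yw | nyw] := boolP ((y, w) \in D).
  have [e [q [eD pq Dq]]] := IHp y Dp wp yw.
  exists e, (y :: q); split=> //=; last by rewrite Dq [arc _ _ _]sD.
  exact: perm_cons_swap.
have [wy | nwy] := boolP ((w, y) \in D).
  exists e0, [:: w, y & p]; split=> //=.
  by rewrite (sub_path (sD _) Dp) ![arc _ _ _]sD.
exists (w, y), [:: w, y & p]; split=> //=.
  by rewrite undirectedN ?nwy //; move: wp; rewrite inE negb_or => /andP[].
by rewrite (sub_path (sD _) Dp) [arc _ x w]sD //= /arc setU11.
Qed.

Lemma extend_path n (D : {set dedge n}) e0 k :
    undirected D e0 -> 0 < k < n -> traceable k D ->
  exists2 e, undirected D e & traceable k.+1 (e |: D).
Proof.
move=> e0D /andP[k0 kn] /traceableP[[|x p] [szp Up Dp]].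
  by rewrite -szp in k0.
have [w wp] : exists w, w \notin x :: p.
  apply/existsP/contraT; rewrite negb_exists => /forallP allp.
  have : #|'I_n| <= size (x :: p).
    rewrite -(card_uniqP Up); apply/subset_leq_card/subsetP => w _.
    by have := allp w; rewrite negbK.
  by rewrite card_ord szp leqNgt kn.
have sD e : subrel (arc D) (arc (e |: D)) by exact/sub_arc/subsetUr.
have prepend e : undirected D e -> arc (e |: D) w x ->
    exists2 e, undirected D e & traceable k.+1 (e |: D).
  move=> eD wx; exists e => //; apply/traceableP; exists [:: w, x & p].
  by rewrite cons_uniq wp Up /= wx (sub_path (sD _) Dp) -szp.
have [xw | nxw] := boolP ((x, w) \in D).
  have [e [q [eD pq Dq]]] := insert_vertex e0D Dp wp xw.
  exists e => //; apply/traceableP; exists (x :: q).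
  have pxq : perm_eq (x :: q) [:: w, x & p].
    exact: perm_cons_swap.
  by rewrite (perm_size pxq) (perm_uniq pxq) cons_uniq wp Up -szp.
have [wx | nwx] := boolP ((w, x) \in D).
  by apply: prepend e0D _; apply: sD.
apply: (prepend (w, x)); last exact: setU11.
by rewrite undirectedN ?nwx //; move: wp; rewrite inE negb_or => /andP[].
Qed.

(** The arc [(u, v)] is absent, so [v] is not the successor of [u] and the
    closed walk has at least three vertices. *)
Lemma close_cycle n (D : {set dedge n}) u v p :
    path (arc D) u p -> uniq (u :: p) -> v \in p -> undirected D (u, v) ->
  cyclic ((v, u) |: D).
Proof.
move=> Dp Up vp /and3P[_ nuv _]; apply/cyclicP.
case/splitPr: vp Dp Up => p1 p2; rewrite -cat_rcons cat_path -cat_cons cat_uniq.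
case/andP=> Dp1 _ /andP[Up1 _]; exists (u :: rcons p1 v).
  case: p1 Dp1 nuv {Up1} => [/andP[uv _] /negP[] | y p1] //= _ _.
  by rewrite size_rcons.
rewrite /ucycle Up1 andbT /= rcons_path last_rcons -/(arc _ v u).
by rewrite [arc _ _ _]setU11 (sub_path _ Dp1) //; apply/sub_arc/subsetUr.
Qed.

Lemma close_spanning_path n (D : {set dedge n}) e :
  undirected D e -> traceable n D ->
  exists2 e', undirected D e' & cyclic (e' |: D).
Proof.
case: e => u v eD /traceableP[s [szs Us Ds]].
have in_s w : w \in s.
  have card_s : #|s| = #|'I_n| by rewrite card_ord (card_uniqP Us).
  by rewrite (subset_cardP card_s (subset_predT _)).
have nuv : u != v by case/and3P: eD.
case/splitPr: (in_s u) (in_s v) Us Ds => s1 s2 + Us Ds.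
rewrite mem_cat inE (eq_sym v) (negPf nuv) /= => /orP[vs1 | vs2].
  have veD : undirected D (v, u) by rewrite -undirected_rev.
  exists (u, v) => //; case/splitPr: vs1 Us Ds => s0 s3.
  rewrite -catA cat_cons cat_uniq => /and3P[_ _ Us] /cat_sorted2[_ Ds].
  by apply: (close_cycle Ds Us _ veD); rewrite mem_cat mem_head orbT.
exists (v, u); first by rewrite -undirected_rev.
move: Us Ds; rewrite cat_uniq => /and3P[_ _ Us] /cat_sorted2[_ Ds].
exact: close_cycle Ds Us vs2 eD.
Qed.

(** Having reached a cycle is kept as an alternative to the longer path, since
    Maker must go on moving after closing one. *)
Lemma advance n k (D : {set dedge n}) :
    0 < k -> ~~ game_over D -> advanced k D ->
  exists A, maker_move D A && advanced k.+1 (D :|: A).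
Proof.
move=> k0 /negPn/existsP[e0 e0D] advD.
suff [e eD adv] : exists2 e, undirected D e & advanced k.+1 (e |: D).
  by exists [set e]; rewrite maker_move1 // setUC.
case/orP: advD => [cycD | trD].
  exists e0 => //; apply: (advancedS (subsetUr _ _)).
  by rewrite /advanced cycD.
have [kn | nk] := ltnP k n.
  have [|e eD tr] := extend_path e0D _ trD; first by rewrite k0.
  by exists e; rewrite // /advanced tr orbT.
have kn : k = n.
  case/traceableP: (trD) => s [szs Us _]; apply/eqP; rewrite eqn_leq nk andbT.
  by rewrite -[leqRHS]card_ord -szs -(card_uniqP Us) max_card.
rewrite kn in trD; have [e eD cyc] := close_spanning_path e0D trD.
by exists e; rewrite // /advanced cyc.
Qed.

(** The path length to aim at is read off the history: before Maker's turn
    [uphalf (size h)] counts Maker's earlier moves.  By [maker_spec] the default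
    [set0] never arises in a play. *)
Definition maker n : strategy n := fun h =>
  let D := position h in
  odflt set0
    [pick A | maker_move D A && advanced (uphalf (size h)).+2 (D :|: A)].

Lemma maker_spec n (h : history n) :
    maker_to_move h -> advanced (uphalf (size h)).+1 (position h) ->
  maker_move (position h) (maker h)
  /\ advanced (uphalf (size h)).+2 (position h :|: maker h).
Proof.
case/andP=> _ over /(advance (ltn0Sn _) over) [A goodA].
rewrite /maker; case: pickP => [B /andP[] // | /(_ A)].
by rewrite goodA.
Qed.

Lemma position_rcons n (h : history n) A :
  position (rcons h A) = position h :|: A.
Proof. by rewrite /position -cats1 big_cat big_seq1. Qed.

Lemma play_advanced n b (h : history n) :
  0 < n -> consistent b (@maker n) h ->
  advanced (uphalf (size h)).+1 (position h).
Proof.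
move=> n0; elim=> {h} [|h _ IHh mh | h A _ IHh /andP[odd_h _] _].
- by apply/orP; right; apply/traceableP; exists [:: Ordinal n0].
- have [_] := maker_spec mh IHh; case/andP: mh => even_h _.
  rewrite position_rcons size_rcons uphalf_half (negPf even_h) add0n.
  by rewrite uphalfE.
- rewrite position_rcons size_rcons.
  have -> : uphalf (size h).+1 = uphalf (size h).
    by rewrite [RHS]uphalf_half odd_h.
  exact: advancedS (subsetUl _ _) IHh.
Qed.

Lemma card_play n b (h : history n) :
  0 < n -> consistent b (@maker n) h ->
  #|position h| <= uphalf (size h) + b * (size h)./2.
Proof.
move=> n0; elim=> {h} [|h ch IHh mh | h A _ IHh /andP[odd_h _] /and3P[_ _ leA]].
- by rewrite /position big_nil cards0.
- have [/andP[_ /eqP cardS] _] := maker_spec mh (play_advanced n0 ch).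
  case/andP: mh => even_h _; rewrite position_rcons size_rcons.
  apply: leq_trans (leq_card_setU _ _) _; rewrite cardS.
  by move: IHh; rewrite /= uphalf_half (negPf even_h); lia.
- rewrite position_rcons size_rcons; apply: leq_trans (leq_card_setU _ _) _.
  rewrite uphalf_half odd_h in IHh.
  by rewrite /= uphalf_half odd_h mulnS addnCA [leqLHS]addnC leq_add.
Qed.

(** Every ordered pair of distinct vertices lies in [D] or in its reversal. *)
Lemma game_over_card n (D : {set dedge n}) :
  game_over D -> n * n.-1 <= #|D|.*2.
Proof.
rewrite /game_over negb_exists => /forallP overD.
pose diag := [set (i, i) | i : 'I_n].
have card_diag : #|diag| = n by rewrite card_imset ?card_ord // => i j [].
have card_off : #|~: diag| = n * n.-1.
  by rewrite cardsCs setCK card_diag card_prod card_ord -subn1 mulnBr muln1.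
rewrite -card_off -addnn.
apply: (@leq_trans #|D :|: (@rev_edge n) @: D|); last first.
  apply: leq_trans (leq_card_setU _ _) _.
  by rewrite leq_add2l leq_imset_card.
apply/subset_leq_card/subsetP => -[u v]; rewrite in_setC => off.
have nuv : u != v.
  by apply: contraNneq off => ->; apply/imsetP; exists v.
move: (overD (u, v)); rewrite undirectedN // negb_and !negbK inE.
by case/orP=> [-> // | vuD]; apply/orP; right; apply/imsetP; exists (v, u).
Qed.

Theorem theorem1 (n b : nat) (hn : 0 < n) (hb : 0 < b)
    (hbn : (b%:R <= n%:R / 2%:R - 2%:R :> rat)%R) :
  exists S : strategy n,
    maker_strategy b S /\ guarantees b S (@has_directed_cycle n).
Proof.
have hbn' : b.*2 + 4 <= n.
  move: hbn; rewrite lerBrDr ler_pdivlMr ?ltr0n // -natrD -natrM ler_nat.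
  by rewrite mulnDl -muln2.
exists (@maker n); split=> [h ch mh | h ch over].
  by have [] := maker_spec mh (play_advanced hn ch).
case/orP: (play_advanced hn ch) => [/cyclicP // | /traceableP[s [szs Us _]]].
have turns : (uphalf (size h)).+1 <= n.
  by rewrite -[leqRHS]card_ord -szs -(card_uniqP Us) max_card.
have few := card_play hn ch; have many := game_over_card over.
have half_le : (size h)./2 <= uphalf (size h) by rewrite uphalf_half leq_addl.
exfalso; move: (uphalf _) ((size h)./2) half_le turns few => t t' t't tn few.
(* At most [n - 1] rounds were played, each orienting at most [b + 1] edges. *)
have : #|position h| <= n.-1 * b.+1 by nia.
nia.
Qed.
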